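(* Let $n\ge1$ and $z\in\mathbb{C}$, and let $f_z(g)=z^{\,n-r(g)}$ for $g\in G_n=GL(n,q)$. Then, as functions on $G_n$, $$f_z=\sum_{j=0}^n\left(z^{n-j}\prod_{i=0}^{j-1}\frac{q^{-i}-z}{q^{i+1}-1}\right)\psi_j^{(n)} .$$
   Context: $q$ is a prime power, $G_n=GL(n,q)$, and $r(g)=\dim\ker(g-1_n)$ for $g\in G_n$. Convention: $z^0=1$ (also for $z=0$) and empty products equal $1$. For $1\le j\le n$, $\psi_j^{(n)}$ is the character of the permutation representation of $G_n$ in $\mathbb{C}[Y_j^{(n)}]$, where $Y_j^{(n)}$ is the set of $n\times j$ matrices over $\mathbb{F}_q$ of rank $j$, with $G_n$ acting by left multiplication; $\psi_0^{(n)}\equiv1$. *)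

(* Defs.v *)
From HB Require Import structures.
From mathcomp Require Import all_boot all_order all_fingroup all_algebra.
From mathcomp Require Import mxrepresentation.

Set Implicit Arguments.
Unset Strict Implicit.
Unset Printing Implicit Defensive.

Import GRing.Theory.

Local Open Scope ring_scope.

(* [{'GL_n[F]}] is the type of invertible matrices of size [n.-1.+1], which is
   [n] for [0 < n]; this is why dimensions below are written [n.-1.+1]. *)

(* dim ker (g - 1), for g acting on column vectors. *)
Definition dim_fix (F : finFieldType) (n : nat) (g : {'GL_n[F]}) : nat :=
  \dim (lker (linfun (mulmx (GLval g - 1%:M) : 'cV[F]_n.-1.+1 -> 'cV[F]_n.-1.+1))).

Notation full_rank_mx F n j := {A : 'M[F]_(n.-1.+1, j) | (\rank A == j)%N}.

Section PermRepr.

Variables (C : fieldType) (F : finFieldType) (n j : nat).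

Local Notation Y := (full_rank_mx F n j).

Lemma rank_GL_mul (g : {'GL_n[F]}) (A : Y) : \rank (GLval g *m val A) == j.
Proof. by rewrite eqmxMfull ?row_full_unit ?GL_unitmx ?(valP A). Qed.

Definition GL_mul (g : {'GL_n[F]}) (A : Y) : Y :=
  exist _ (GLval g *m val A) (rank_GL_mul g A).

(* The matrix, on column vectors and in the basis Y of C[Y], of the linear map
   sending each basis vector A to g A. *)
Definition perm_repr_mx (g : {'GL_n[F]}) : 'M[C]_#|{: Y}| :=
  \matrix_(a, b) (enum_val a == GL_mul g (enum_val b))%:R.

Lemma perm_repr_mxP : mx_repr 'GL_n[F] perm_repr_mx.
Proof.
split=> [|g h _ _]; apply/matrixP=> a b; rewrite !mxE.
  congr (nat_of_bool _)%:R; rewrite -(inj_eq enum_val_inj).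
  by congr (_ == _); apply: val_inj; rewrite /= mul1mx.
rewrite (bigD1 (enum_rank (GL_mul h (enum_val b)))) //= !mxE enum_rankK eqxx.
rewrite mulr1 big1 ?addr0 => [|c].
  congr (nat_of_bool (_ == _))%:R; apply: val_inj => /=.
  by rewrite mulmxA.
by rewrite !mxE -(inj_eq enum_val_inj) enum_rankK => /negPf->; rewrite mulr0.
Qed.

Canonical perm_repr := MxRepresentation perm_repr_mxP.

End PermRepr.

Definition psi (C : fieldType) (F : finFieldType) (n j : nat)
    (g : {'GL_n[F]}) : C :=
  if j == 0%N then 1 else \tr (perm_repr C F n j g).

(* Main.v *)
Require Import Defs.
From HB Require Import structures.
From mathcomp Require Import all_boot all_order all_fingroup all_algebra.
From mathcomp Require Import all_field mxabelem ring.
From mathcomp Require Import reals complex.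

(** Everything depends on g only through the dimension r of the fixed space of
    g.  The value psi_j(g) is the number of n x j matrices A of rank j with
    g A = A, i.e. of linearly independent j-tuples of vectors of ker (g - 1)
    ([psiE]).  Choosing the vectors one at a time, each outside the span of its
    predecessors, gives (q^r - 1) (q^r - q) ... (q^r - q^(j-1)) such tuples
    ([card_full_rank_sub]).

    Multiplied by this number, the j-th product in the statement becomes the
    Gaussian binomial coefficient [r choose j]_q times
    (1 - z) (1 - z q) ... (1 - z q^(j-1)), and the theorem reduces to a finite
    form of the q-binomial theorem,
      sum_j [r choose j]_q z^(m-j) (1 - z) ... (1 - z q^(j-1)) = z^(m-r)
    for r <= m ([qbin_sum]).  By the Pascal rule ([qbin_pascal]), the left-hand
    side does not change when r and m are both increased by one, so it equals
    its value z^(m-r) at r = 0. *)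

Set Implicit Arguments.
Unset Strict Implicit.
Unset Printing Implicit Defensive.

Import Order.TTheory GRing.Theory Num.Theory.

Local Open Scope ring_scope.

Section GaussianBinomial.

Variables (C : fieldType) (q : C).
Hypothesis q_neq0 : q != 0.
Hypothesis q_nonroot : forall i, q ^+ i.+1 - 1 != 0.

(** The Gaussian binomial coefficient [r choose j]_q.  Its numerator is the
    number of independent j-tuples in a space of dimension r, and its
    denominator is that number for r = j: the i-th factor q^j - q^i of the
    latter is q^i (q^(j-i) - 1), and the second halves q^(j-i) - 1 are taken
    here in reverse order. *)
Definition qbin r j : C :=
  \prod_(0 <= i < j) ((q ^+ r - q ^+ i) / (q ^+ i * (q ^+ i.+1 - 1))).

(** The q-Pochhammer symbol (z; q)_j. *)
Definition qpoch (z : C) j : C := \prod_(0 <= i < j) (1 - z * q ^+ i).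

Lemma qbin0 r : qbin r 0 = 1.
Proof. by rewrite /qbin big_geq. Qed.

Lemma qbin_recr r j :
  qbin r j.+1 = qbin r j * ((q ^+ r - q ^+ j) / (q ^+ j * (q ^+ j.+1 - 1))).
Proof. by rewrite /qbin big_nat_recr. Qed.

Lemma qbin_small r j : (r < j)%N -> qbin r j = 0.
Proof.
move=> r_lt_j; rewrite /qbin (big_cat_nat (n := r)) ?(ltnW r_lt_j) //=.
by rewrite (big_ltn r_lt_j) subrr !mul0r mulr0.
Qed.

Lemma qbin_absorb r j :
  qbin r.+1 j.+1 = (q ^+ r.+1 - 1) / (q ^+ j.+1 - 1) * qbin r j.
Proof.
elim: j => [|j IHj]; first by rewrite qbin_recr !qbin0 expr0 !mul1r mulr1.
rewrite qbin_recr IHj [qbin r j.+1]qbin_recr.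
have qj_neq0 : q ^+ j != 0 by rewrite expf_neq0.
have := q_nonroot j; have := q_nonroot j.+1; rewrite !exprS => nz2 nz1.
by field; rewrite qj_neq0 q_neq0 nz1 nz2.
Qed.

Lemma qbin_pascal r j :
  qbin r.+1 j.+1 = qbin r j + q ^+ j.+1 * qbin r j.+1.
Proof.
rewrite qbin_absorb qbin_recr.
have qj_neq0 : q ^+ j != 0 by rewrite expf_neq0.
have := q_nonroot j; rewrite !exprS => nz1.
by field; rewrite qj_neq0 nz1.
Qed.

(** In the Pascal expansion for r + 1 and m + 1, the two terms containing
    [qbin r j] add up to the j-th term for r and m, because
    z q^j + (1 - z q^j) = 1. *)
Lemma qbin_sum (z : C) r m : (r <= m)%N ->
  \sum_(0 <= j < m.+1) z ^+ (m - j) * (qpoch z j * qbin r j) = z ^+ (m - r).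
Proof.
elim: r m => [|r IHr] [|m] //.
- by rewrite big_nat1 qbin0 /qpoch big_geq // !mulr1.
- rewrite big_nat_recl // big1 => [|j _]; last by rewrite qbin_small // !mulr0.
  by rewrite qbin0 /qpoch big_geq // !mulr1 addr0.
rewrite ltnS subSS => r_le_m; rewrite -IHr // big_nat_recl //.
under eq_bigr do rewrite qbin_pascal subSS !mulrDr.
rewrite big_split /= addrCA.
(* The case j = 0, which the Pascal rule does not cover, supplies the missing
   term of the sum of the q^j [qbin r j]. *)
have -> : z ^+ (m.+1 - 0) * (qpoch z 0 * qbin r.+1 0) +
    \sum_(0 <= j < m.+1) z ^+ (m - j) *
       (qpoch z j.+1 * (q ^+ j.+1 * qbin r j.+1)) =
    \sum_(0 <= j < m.+2) z ^+ (m.+1 - j) * (qpoch z j * (q ^+ j * qbin r j)).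
  by rewrite [RHS]big_nat_recl // !qbin0 expr0 mul1r.
(* The extra term j = m + 1 is zero because r <= m. *)
rewrite [X in _ + X]big_nat_recr //= qbin_small // !mulr0 addr0 -big_split /=.
apply: eq_big_nat => j /andP[_ j_le_m]; rewrite subSn //.
rewrite [qpoch z j.+1]/qpoch big_nat_recr //= -/(qpoch z j) exprS.
by ring.
Qed.

Lemma qpoch_qbinE (z : C) r j :
  \prod_(0 <= i < j) ((q ^- i - z) / (q ^+ i.+1 - 1))
    * \prod_(0 <= i < j) (q ^+ r - q ^+ i) = qpoch z j * qbin r j.
Proof.
rewrite -!big_split; apply: eq_bigr => i _ /=.
have qi_neq0 : q ^+ i != 0 by rewrite expf_neq0.
have := q_nonroot i; rewrite !exprS => nz.
by field; rewrite qi_neq0 nz.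
Qed.

End GaussianBinomial.

Section Counting.

Variable F : finFieldType.

Lemma col_mx_full_rank n j (u : 'rV[F]_n) (B : 'M[F]_(j, n)) :
  (\rank (col_mx u B) == j.+1) = (\rank B == j) && ~~ (u <= B)%MS.
Proof.
rewrite -addsmxE; case: (boolP (u <= B)%MS) => [uB | nuB].
  rewrite andbF; apply/negbTE; rewrite (addsmx_idPr uB) neq_ltn ltnS.
  by rewrite rank_leq_row.
rewrite andbT; have B_lt : (\rank B < \rank (u + B)%MS)%N.
  apply: rank_ltmx; rewrite /ltmx addsmxSr; apply: contra nuB.
  exact: submx_trans (addsmxSl _ _).
have uB_le : (\rank (u + B)%MS <= (\rank B).+1)%N.
  apply: leq_trans (mxrank_adds_leqif _ _) _.
  by rewrite -[leqRHS]add1n leq_add2r rank_leq_row.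
by have/eqP-> : \rank (u + B)%MS == (\rank B).+1; rewrite ?eqSS // eqn_leq uB_le.
Qed.

Lemma full_rank_sub_col_mx m n j (K : 'M[F]_(m, n))
    (u : 'rV[F]_n) (B : 'M[F]_(j, n)) :
  ((col_mx u B : 'M_(j.+1, n)) \in [set A : 'M[F]_(j.+1, n) | (A <= K)%MS && (\rank A == j.+1)])
  = (B \in [set A : 'M[F]_(j, n) | (A <= K)%MS && (\rank A == j)])
    && (u \in rowg K :\: rowg B).
Proof.
rewrite !inE col_mx_full_rank.
have -> : ((col_mx u B : 'M_(j.+1, n)) <= K)%MS =
      (u <= K)%MS && (B <= K)%MS.
  exact: (@col_mx_sub _ 1 j).
by case: (u <= K)%MS; case: (B <= K)%MS; rewrite /= ?andbF ?andbT.
Qed.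

(** A full-rank matrix with j + 1 rows is a full-rank matrix B with j rows on
    top of which is put a vector of the row space of K outside that of B; there
    are q ^ \rank K - q ^ j such vectors, for every B.  When \rank K < j, the
    natural subtractions are harmless: the factor of index \rank K is 0. *)
Lemma card_full_rank_sub m n (K : 'M[F]_(m, n)) j :
  #|[set A : 'M[F]_(j, n) | (A <= K)%MS && (\rank A == j)]| =
  (\prod_(0 <= i < j) (#|F| ^ \rank K - #|F| ^ i))%N.
Proof.
elim: j => [|j IHj].
  rewrite big_geq //; apply/eqP/cards1P; exists 0; apply/setP=> A.
  by rewrite !inE [A]flatmx0 sub0mx mxrank0 !eqxx.
rewrite big_nat_recr //= -IHj -sum_nat_const -sum1_card.
rewrite (partition_big (fun A : 'M_(1 + j, n) => dsubmx A)
  (mem [set A : 'M[F]_(j, n) | (A <= K)%MS && (\rank A == j)])) /=; last first.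
  move=> A; rewrite -[A](@vsubmxK _ 1 j) full_rank_sub_col_mx col_mxKd.
  by case/andP.
apply: eq_bigr => B SB; have := SB; rewrite inE => /andP[BK /eqP rB].
rewrite sum1_card.
have -> : (#|F| ^ \rank K - #|F| ^ j)%N = #|rowg K :\: rowg B|.
  rewrite cardsD; move: (BK); rewrite -rowgS => /setIidPr->.
  by rewrite !card_rowg rB.
rewrite -(card_imset _ (f := fun u : 'rV_n => col_mx u B)); last first.
  by move=> u v /eq_col_mx[].
apply: eq_card => A; rewrite unfold_in; apply/idP/imsetP.
  rewrite -[A](@vsubmxK _ 1 j) full_rank_sub_col_mx col_mxKd.
  by case/andP=> [/andP[_ uKB] /eqP eB]; exists (usubmx A); rewrite -?eB.
by case=> u uKB ->; rewrite full_rank_sub_col_mx col_mxKd SB uKB eqxx.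
Qed.

(** Transposition maps the space of column vectors fixed by g onto the row
    space of this kernel; both have q ^ dimension elements, so comparing
    cardinals is enough. *)
Lemma dim_fixE n (g : {'GL_n[F]}) :
  dim_fix g = \rank (kermx (GLval g - 1%:M)^T).
Proof.
apply: (expnI (card_finNzRing_gt1 F)); rewrite -[RHS]card_rowg /dim_fix.
set V := lker _; rewrite -[LHS]card_vspace {}/V.
rewrite -(card_imset _ (@trmx_inj _ _ _)); apply: eq_card => u.
rewrite inE sub_kermx -[u]trmxK (mem_imset _ _ (@trmx_inj _ _ _)).
by rewrite memv_ker lfunE /= -trmx_mul trmx_eq0.
Qed.

(** The trace of a permutation matrix counts the fixed points, here the A with
    (g - 1) A = 0; their transposes are the matrices of
    [card_full_rank_sub] for the kernel of [dim_fixE].  For j = 0 both sides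
    are 1. *)
Lemma psiE (C : fieldType) n j (g : {'GL_n[F]}) :
  psi C j g =
  (\prod_(0 <= i < j) (#|F| ^ dim_fix g - #|F| ^ i))%N%:R.
Proof.
rewrite /psi; case: eqP => [->|_]; first by rewrite big_geq.
rewrite dim_fixE -card_full_rank_sub /mxtrace /=.
under eq_bigr do rewrite mxE.
rewrite -natr_sum; congr _%:R.
rewrite -(big_enum_val (fun A : full_rank_mx F n j =>
  nat_of_bool (A == GL_mul g A))) -big_mkcond sum1dep_card.
rewrite -(card_imset _ (f := fun A : full_rank_mx F n j => (val A)^T)); last first.
  by move=> A B /trmx_inj/val_inj.
apply: eq_card => B; rewrite inE; apply/imsetP/idP.
  case=> A; rewrite inE => /eqP/(congr1 val)/= gA ->.
  rewrite mxrank_tr (valP A) andbT sub_kermx -trmx_mul mulmxBl mul1mx -gA.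
  by rewrite subrr trmx0.
case/andP; rewrite sub_kermx -[B]trmxK -trmx_mul trmx_eq0 mulmxBl mul1mx.
rewrite subr_eq0 mxrank_tr => /eqP gB rB; exists (exist _ B^T rB) => //.
by rewrite inE; apply/eqP/val_inj; rewrite /= gB.
Qed.

Lemma psi_prodE (C : fieldType) n j (g : {'GL_n[F]}) :
  psi C j g = \prod_(0 <= i < j) (#|F|%:R ^+ dim_fix g - #|F|%:R ^+ i).
Proof.
rewrite psiE natr_prod; case: (leqP j (dim_fix g)) => [j_le_r | r_lt_j].
  apply: eq_big_nat => i /andP[_ i_lt_j]; rewrite natrB ?natrX //.
  by rewrite leq_pexp2l ?(ltnW (card_finNzRing_gt1 F)) // (leq_trans (ltnW i_lt_j)).
(* Both products vanish, by their factor of index r = dim_fix g. *)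
rewrite [LHS](big_cat_nat (n := dim_fix g)) ?(ltnW r_lt_j) //=.
rewrite [RHS](big_cat_nat (n := dim_fix g)) ?(ltnW r_lt_j) //=.
by rewrite !(big_ltn r_lt_j) subnn subrr !mul0r !mulr0.
Qed.

End Counting.

Theorem proposition10 (R : realType) (F : finFieldType) (n : nat)
    (n_gt0 : (0 < n)%N) (z : R[i]) :
  let q : R[i] := (#|F|)%:R in
  (fun g : {'GL_n[F]} => z ^+ (n - dim_fix g)) =1
  (fun g : {'GL_n[F]} =>
     \sum_(0 <= j < n.+1)
        (z ^+ (n - j) * \prod_(0 <= i < j) ((q ^- i - z) / (q ^+ i.+1 - 1)))
        * psi R[i] j g).
Proof.
move=> q g /=.
have q_gt1 : 1 < q by rewrite ltr1n card_finNzRing_gt1.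
have q_neq0 : q != 0 by rewrite gt_eqF // (lt_trans ltr01).
have q_nonroot i : q ^+ i.+1 - 1 != 0 by rewrite subr_eq0 gt_eqF // exprn_egt1.
have r_le_n : (dim_fix g <= n)%N.
  by rewrite dim_fixE -[n in (_ <= n)%N](prednK n_gt0) rank_leq_col.
rewrite -(qbin_sum q_neq0 q_nonroot z r_le_n); apply: eq_bigr => j _.
by rewrite psi_prodE -mulrA qpoch_qbinE.
Qed.
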